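(* Let $n\ge 1$ and $\Lambda=\mathbb{Z}^n$. In each of the following cases the inequality $$ \left(\prod_{i=1}^r \lambda_i(K,\Lambda)\right)\rho_{L}^{\,n-r}\ \ge\ \frac{2^r (n-r)!}{n!}\,\frac{\det(\Lambda)}{\operatorname{vol}_n(K)}, \qquad \rho_L=\mu(\pi_L(K),\pi_L(\Lambda)), $$ holds with equality: (i) $r=0$, $K=[-\tfrac12,\tfrac12]^n$, $L=\{0\}$; (ii) $r=n$, $K=\{x\in\mathbb{R}^n:\|x\|_1\le 1\}$, $L=\mathbb{R}^n$; (iii) $0<r<n$, $T\ge 1$ real, $$ K=J_{n,r,T}=\left\{(x,y)\in\mathbb{R}^r\times\mathbb{R}^{n-r}:\frac{\|x\|_1}{T}+\|y\|_\infty\le 1\right\},\qquad L=\mathbb{R}^r\times\{0\}. $$ Here $\pi_L:\mathbb{R}^n\to L^\perp$ is the orthogonal projection; in case (ii) the factor $\rho_L^{\,n-r}=\rho_L^{0}$ is by convention $1$, and an empty product equals $1$.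
   Context: The $i$-th successive minimum ($1\le i\le n$) of an origin-symmetric convex body $K\subset\mathbb{R}^n$ (compact, convex, nonempty interior, $K=-K$) with respect to a full-rank lattice $\Lambda\subset\mathbb{R}^n$ is $\lambda_i(K,\Lambda)=\min\{\lambda>0:\dim(\lambda K\cap\Lambda)\ge i\}$, where $\dim(A)$ is the dimension of the linear span of $A$. $\operatorname{vol}_n$ is $n$-dimensional Lebesgue measure and $\det(\Lambda)=|\det B|$ for a basis matrix $B$ of $\Lambda$, so $\det(\mathbb{Z}^n)=1$. The covering radius of a convex body $C$ with respect to a full-rank lattice $\Gamma$ in a Euclidean space $V$ is $\mu(C,\Gamma)=\inf\{\mu>0:\mu C+\Gamma=V\}$; for $\pi_L(K)$ and $\pi_L(\Lambda)$ the ambient space is $V=L^\perp$. In each case $L$ is spanned by $v_i=e_i$, $1\le i\le r$ (standard basis vectors); these are linearly independent lattice vectors with $v_i\in\lambda_i(K,\Lambda)K$. *)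

(* Defs.v *)
From HB Require Import structures.
From mathcomp Require Import all_boot all_order all_algebra.
From mathcomp Require Import all_classical all_reals all_analysis.

Set Implicit Arguments.
Unset Strict Implicit.
Unset Printing Implicit Defensive.

Import Order.TTheory GRing.Theory Num.Theory.

Local Open Scope classical_set_scope.
Local Open Scope ring_scope.

(* Lebesgue measure on R^n, on n-tuples: the n-fold product of the
   one-dimensional Lebesgue measure; see [tuple_lebesgue_box]. *)
Section tuple_lebesgue.
Context {R : realType}.
Local Notation mR := (measurableTypeR R).

Definition tcons n (p : mR * n.-tuple mR) : n.+1.-tuple mR :=
  [tuple of p.1 :: p.2].

Lemma measurable_tcons n : measurable_fun setT (@tcons n).
Proof. by apply: measurable_cons; [exact: measurable_fst|exact: measurable_snd]. Qed.

Section step.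
Context n (m : {sigma_finite_measure set (n.-tuple mR) -> \bar R}).

Definition tuple_leb_step : set (n.+1.-tuple mR) -> \bar R :=
  pushforward (lebesgue_measure \x m)%E (@tcons n).

Let step0 : tuple_leb_step set0 = 0%E.
Proof. by rewrite /tuple_leb_step /pushforward preimage_set0 measure0. Qed.

Let step_ge0 A : (0 <= tuple_leb_step A)%E.
Proof. by rewrite /tuple_leb_step /pushforward measure_ge0. Qed.

Let step_sigma_additive : semi_sigma_additive tuple_leb_step.
Proof.
move=> F mF tF mUF; rewrite /tuple_leb_step /pushforward preimage_bigcup.
have mt A : measurable A -> measurable (@tcons n @^-1` A).
  by move=> mA; rewrite -[X in measurable X]setTI; exact: measurable_tcons.
apply: measure_semi_sigma_additive.
- by move=> k; exact: mt.
- apply/trivIsetP => /= i j _ _ ij; rewrite -preimage_setI.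
  by move/trivIsetP : tF => /(_ _ _ _ _ ij) ->//; rewrite preimage_set0.
- by rewrite -preimage_bigcup; exact: mt.
Qed.

HB.instance Definition _ := isMeasure.Build _ _ _ tuple_leb_step
  step0 step_ge0 step_sigma_additive.

Let step_sigma_finite : sigma_finite setT tuple_leb_step.
Proof.
have /sigma_finiteP[F [TF ndF mF]] := sigma_finiteT (@lebesgue_measure R).
have /sigma_finiteP[G [TG ndG mG]] := sigma_finiteT m.
pose g (t : n.+1.-tuple mR) : mR * n.-tuple mR := (thead t, [tuple of behead t]).
have mg : measurable_fun setT g.
  apply: measurable_fun_pair; first exact: (measurable_tnth ord0).
  exact: measurable_behead.
have gK : cancel (@tcons n) g.
  by move=> [x t]; rewrite /g /tcons theadE; congr pair; exact/val_inj.
exists (fun k => g @^-1` (F k `*` G k)).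
  rewrite -preimage_bigcup predeqE => t; split=> // _.
  have [i _ Fi] : (\bigcup_k F k) (g t).1 by rewrite -TF.
  have [j _ Gj] : (\bigcup_k G k) (g t).2 by rewrite -TG.
  exists (maxn i j) => //; split.
    by move: Fi; exact/subsetPset/ndF/leq_maxl.
  by move: Gj; exact/subsetPset/ndG/leq_maxr.
move=> k; have [mFk Fkoo] := mF k; have [mGk Gkoo] := mG k; split.
  by rewrite -[X in measurable X]setTI; apply: mg => //; exact: measurableX.
rewrite /tuple_leb_step /pushforward -comp_preimage.
rewrite (_ : g \o _ = id); last by apply/funext => p; exact: gK.
by rewrite preimage_id product_measure1E// lte_mul_pinfty// ge0_fin_numE.
Qed.

HB.instance Definition _ := Measure_isSigmaFinite.Build _ _ _ tuple_leb_step
  step_sigma_finite.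

End step.

Fixpoint tuple_lebesgue n : {sigma_finite_measure set (n.-tuple mR) -> \bar R} :=
  if n is k.+1 then tuple_leb_step (tuple_lebesgue k) else \d_[tuple].

End tuple_lebesgue.

Lemma tuple_lebesgue_box (R : realType) n (A : 'I_n -> set (measurableTypeR R)) :
  (forall i, measurable (A i)) ->
  tuple_lebesgue n [set t | forall i, A i (tnth t i)] = (\prod_(i < n) lebesgue_measure (A i))%E.
Proof.
elim: n A => [|n IH] A mA.
  by rewrite big_ord0 /= diracE mem_set//= => -[].
rewrite big_ord_recl /= /tuple_leb_step /pushforward.
rewrite [X in product_measure1 _ _ X](_ : _ = A ord0 `*` [set t | forall i, A (lift ord0 i) (tnth t i)]).
  rewrite product_measure1E//; first by congr (_ * _)%E; apply: (IH (fun i => A (lift ord0 i))) => i; exact: mA.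
  have -> : [set t | forall i, A (lift ord0 i) (tnth t i)] = \bigcap_(i in setT)
      ((@tnth n (measurableTypeR R))^~ i @^-1` A (lift ord0 i)).
    by apply/seteqP; split=> t /= h i; [move=> _|]; exact: h.
  have mI i : measurable ((@tnth n (measurableTypeR R))^~ i @^-1` A (lift ord0 i)).
    by rewrite -[X in measurable X]setTI; apply: (measurable_tnth i) => //; exact: mA.
  have fD : finite_set [set: 'I_n] by exact: finite_finset.
  exact: (@fin_bigcap_measurable _ _ _ _ _ fD (fun i _ => mI i)).
apply/seteqP; split=> [[x t]/= h|[x t]/= [h0 h1] i].
  split=> [|i]; first by have := h ord0; rewrite /tcons (tnth_nth x).
  by have := h (lift ord0 i); rewrite tnthS; congr (A _ _); congr tnth; apply/val_inj.
case: (unliftP ord0 i) => [j ->|->].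
  by rewrite tnthS; have := h1 j; congr (A _ _); congr tnth; apply/val_inj.
by rewrite (tnth_nth x).
Qed.

(* A set of row vectors is read as a set of coordinate tuples. *)
Definition vol (R : realType) n (K : set 'rV[R]_n) : \bar R :=
  tuple_lebesgue n
    [set t : n.-tuple (measurableTypeR R) | K (\row_i tnth t i)].

Section euclidean.
Context {R : realType} {n : nat}.
Local Notation E := 'rV[R]_n.

Definition dilate (a : R) (A : set E) : set E := [set a *: x | x in A].

(* The least subspace containing A; [lspanP] shows that it exists, so the
   default value is never used. *)
Definition lspan (A : set E) : {vspace E} :=
  xget 0%VS [set V : {vspace E} | A `<=` [set` V] /\
    forall W : {vspace E}, A `<=` [set` W] -> (V <= W)%VS].

Lemma lspanP (A : set E) : A `<=` [set` lspan A] /\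
  forall W : {vspace E}, A `<=` [set` W] -> (lspan A <= W)%VS.
Proof.
rewrite /lspan; case: xgetP => [V _ //|none].
suff noU d (U : {vspace E}) : A `<=` [set` U] -> (\dim U < d)%N -> False.
  by case: (noU (\dim {:E}).+1 {:E}%VS) => // x _; exact: memvf.
elim: d U => // d IHd U AU; rewrite ltnS => dU; case: (none U); split=> // W AW.
have [//|UW] := boolP (U <= W)%VS.
case: (IHd (U :&: W)%VS); last first.
  apply: leq_trans dU; rewrite ltn_neqAle dimvS ?capvSl// andbT.
  apply: contra UW => /eqP dUW; have /eqP <- : (U :&: W)%VS == U.
    by rewrite eqEdim capvSl dUW leqnn.
  by rewrite capvSr.
by move=> x Ax /=; rewrite memv_cap; apply/andP; split; [exact: AU|exact: AW].
Qed.

Definition sdim (A : set E) : nat := \dim (lspan A).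

(* The default value 0 is taken only if the minimum is not attained. *)
Definition set_min (S : set R) : R := xget 0 (S `&` lbound S).

Definition succ_min (i : nat) (K Lam : set E) : R :=
  set_min [set l | 0 < l /\ (i <= sdim (dilate l K `&` Lam))%N].

Definition int_lattice : set E := [set x : E | forall i, x 0 i \is a Num.int].

Definition basis_mx (B : 'M[R]_n) (Lam : set E) : Prop :=
  B \in unitmx /\ Lam = [set z *m B | z in int_lattice].

(* The value does not depend on the choice of the basis matrix (row basis); the
   default value 0 is taken only if Lam has no basis matrix. *)
Definition lattice_det (Lam : set E) : R :=
  `|\det (xget 0 [set B | basis_mx B Lam])|.

Definition dotv (u v : E) : R := \sum_i u 0 i * v 0 i.

Let dotv_bilinear :
  bilinear_for
    (GRing.Scale.Law.clone _ _ *%R _) (GRing.Scale.Law.clone _ _ (idfun \; *%R) _)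
    dotv.
Proof.
split=> [w|w] a u v; rewrite /= /dotv mulr_sumr -big_split/=; apply: eq_bigr => i _.
  by rewrite !mxE mulrDl mulrA.
by rewrite !mxE mulrDr mulrCA.
Qed.

HB.instance Definition _ := bilinear_isBilinear.Build R E E R
  *%R (idfun \; *%R) dotv dotv_bilinear.

Let dotv_sym u v : dotv u v = (-1) ^+ false * idfun (dotv v u).
Proof. by rewrite mul1r; apply: eq_bigr => i _; rewrite mulrC. Qed.

HB.instance Definition _ :=
  isHermitianSesquilinear.Build R E false idfun dotv dotv_sym.

Let dotv_gt0 u : u != 0 -> 0 < dotv u u.
Proof.
move=> /eqP u0; have [i ui] : exists i, u 0 i != 0.
  apply: contrapT => h; apply: u0; apply/rowP => i; rewrite mxE.
  by apply/eqP; apply: contrapT => ui; apply: h; exists i; apply/negP.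
rewrite /dotv (bigD1 i)//= ltr_wpDr ?sumr_ge0// => [j _|].
  by rewrite -expr2 sqr_ge0.
by rewrite -expr2 exprn_even_gt0.
Qed.

HB.instance Definition _ := isDotProduct.Build R E dotv dotv_gt0.

(* Orthogonal projection onto the orthogonal complement of L; see [proj_perpP]. *)
Definition proj_perp (L : {vspace E}) : 'End(E) := daddv_pi (orthov dotv L) L.

Lemma orthov_capv (L : {vspace E}) : (orthov dotv L :&: L = 0)%VS.
Proof.
apply/eqP; rewrite -subv0; apply/subvP => x; rewrite memv_cap memv0.
move=> /andP[/mem_orthovP xL Lx]; apply: contraT => x0.
by have := @neq0_dnorm_gt0 _ _ _ dotv x x0; rewrite (xL x Lx) ltxx.
Qed.

Lemma orthov_addv (L : {vspace E}) : (orthov dotv L + L = fullv)%VS.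
Proof.
apply/eqP; rewrite eqEdim subvf dimv_disjoint_sum ?orthov_capv//=.
suff H (s : seq E) : (\dim {:E} <= \dim (orthov dotv (span s)) + size s)%N.
  by have := H (vbasis L); rewrite size_tuple (span_basis (vbasisP L)).
elim: s => [|u s IH]; first by rewrite span_nil orthov0 addn0.
have -> : orthov dotv (span (u :: s)) = (orthov dotv (span s) :&: orthov dotv <[u]>)%VS.
  have := subvv (orthov dotv (<[u]> + span s)%VS).
  rewrite orthovD => /andP[h1 h2].
  apply/eqP; rewrite span_cons eqEsubv; apply/andP; split.
    by rewrite subv_cap h1 h2.
  by rewrite orthovD capvSr capvSl.
have := @leq_dim_orthov1 _ _ _ _ dotv u (orthov dotv (span s)).
move: IH; rewrite /=; case: (\dim (orthov _ (span s))) => [|d] /= h1 h2.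
  by rewrite add0n in h1; rewrite addnS (leq_trans h1)// -addSn leq_addl.
by rewrite (leq_trans h1)// addSnnS leq_add2r.
Qed.

Lemma proj_perpP (L : {vspace E}) (x : E) :
  proj_perp L x \in orthov dotv L /\ x - proj_perp L x \in L.
Proof.
split; first exact: memv_pi.
rewrite -{1}(daddv_pi_add (orthov_capv L) (w := x)) ?orthov_addv ?memvf//.
by rewrite addrAC subrr add0r memv_pi.
Qed.

(* The default value 0 of [inf] is taken only if no dilate of C covers V. *)
Definition covering_radius (V : {vspace E}) (C Gam : set E) : R :=
  inf [set mu | 0 < mu /\
    [set x + g | x in dilate mu C & g in Gam] = [set` V]].

Definition norm1 (x : E) : R := \sum_i `|x 0 i|.

Definition cube : set E := [set x : E | forall i, - 2^-1 <= x 0 i <= 2^-1].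

Definition cross_polytope : set E := [set x : E | norm1 x <= 1].

(* R^n is split as R^r x R^(n-r): the coordinates of index i < r form the first
   block and those of index i >= r the second one. *)
Definition Jbody (r : nat) (T : R) : set E :=
  [set z : E | (\sum_(i < n | (i < r)%N) `|z 0 i|) / T +
           \big[Num.max/0]_(i < n | (r <= i)%N) `|z 0 i| <= 1].

(* R^r x {0}, the span of the first r standard basis vectors. *)
Definition coord_space (r : nat) : {vspace E} :=
  span [seq delta_mx 0 i : E | i : 'I_n <- enum 'I_n & (i < r)%N].

(* mathcomp has 0 ^+ 0 = 1, which matters when n = r, as the covering radius is
   then 0. *)
Definition covering_product (r : nat) (K Lam : set E) (L : {vspace E}) : R :=
  (\prod_(1 <= i < r.+1) succ_min i K Lam) *
  covering_radius (orthov dotv L) (proj_perp L @` K) (proj_perp L @` Lam)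
    ^+ (n - r).

Definition volume_bound (r : nat) (K Lam : set E) : R :=
  (2 ^+ r * (n - r)`!%:R) / n`!%:R * (lattice_det Lam / fine (vol K)).

End euclidean.

Arguments int_lattice R n : clear implicits.
Arguments cube R n : clear implicits.
Arguments cross_polytope R n : clear implicits.
Arguments Jbody R n r T : clear implicits.
Arguments coord_space R n r : clear implicits.

(* Main.v *)
Require Import Defs.
From mathcomp Require Import all_boot all_order all_algebra.
From mathcomp Require Import all_classical all_reals all_analysis.
From mathcomp Require Import measurable_realfun.
From mathcomp Require Import ring lra zify.

Import Order.TTheory GRing.Theory Num.Theory.
Import numFieldNormedType.Exports.

Local Open Scope classical_set_scope.
Local Open Scope ring_scope.

(** Both sides of the equality can be computed exactly, and the three cases are
handled together.  With x the first r coordinates of a point and y the others,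
the cube, the cross-polytope and J_(n,r,T) are all of the form
|x|_1 / T + |y|_oo <= s, respectively with (r, T, s) = (0, 1, 1/2), (n, 1, 1)
and (r, T, 1).

Volume ([vol_Jsublevel]): integrating over the first coordinate t replaces
(n, r, s) by (n - 1, r - 1, s - |t| / T), and for r = 0 the body is the cube
[-s, s]^n.  Since the integral of (s - |t| / T)^(n-1) over |t| <= T s is
2 T s^n / n, the volume is 2^n T^r s^n (n-r)! / n!.

Successive minima ([succ_min_Jsublevel], for s = 1): if l < 1/T <= 1, every
coordinate of a point of l K is less than 1 in absolute value, so that 0 is the
only lattice point there; at l = 1/T the vectors e_1, ..., e_r appear.  Hence
the first r minima are all 1/T.

Covering radius ([covering_radius_flatbox]): the projection along the first r
coordinates maps the body onto the cube [-s, s]^(n-r) and Z^n onto Z^(n-r).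
Rounding each coordinate shows that the dilate by 1/(2s) covers, and the point
(1/2, ..., 1/2) is not covered by any smaller one.

As det Z^n = 1 ([lattice_det_int]), both sides are equal to
T^(-r) (2s)^(-(n-r)). *)

(** * The common family of bodies *)

(** The length that the first r coordinates leave for the sup norm of the
others. *)
Definition slack (R : realType) (n r : nat) (T s : R) (z : 'rV[R]_n) : R :=
  s - (\sum_(i < n | (i < r)%N) `|z 0 i|) / T.

(** The set |x|_1 / T + |y|_oo <= s.  The maximum is spelled out as bounds on
each coordinate; [0 <= slack] still has to be required when r = n, where no
such bound is left. *)
Definition Jsublevel (R : realType) (n r : nat) (T s : R) : set 'rV[R]_n :=
  [set z | 0 <= slack R n r T s z /\
     forall i : 'I_n, (r <= i)%N -> `|z 0 i| <= slack R n r T s z].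

Lemma Jbody_Jsublevel (R : realType) (n r : nat) (T : R) :
  Jbody R n r T = Jsublevel R n r T 1.
Proof.
apply/seteqP; split=> z; rewrite /Jbody /Jsublevel /slack /=.
  by rewrite addrC -lerBrDr => /bigmax_leP.
by move=> h; rewrite addrC -lerBrDr; apply/bigmax_leP.
Qed.

Lemma cross_polytope_Jsublevel (R : realType) (n : nat) :
  cross_polytope R n = Jsublevel R n n 1 1.
Proof.
have slackE z : slack R n n 1 1 z = 1 - norm1 z.
  by rewrite /slack divr1; congr (_ - _); apply: eq_bigl => i; rewrite ltn_ord.
apply/seteqP; split=> z; rewrite /cross_polytope /Jsublevel /= slackE subr_ge0.
  by move=> h; split=> // i; rewrite leqNgt ltn_ord.
by case.
Qed.

Lemma cube_Jsublevel (R : realType) (n : nat) : cube R n = Jsublevel R n 0 1 2^-1.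
Proof.
apply/seteqP; split=> z; rewrite /cube /Jsublevel /slack /= big_pred0_eq mul0r subr0.
  by move=> h; rewrite invr_ge0 ler0n; split=> // i _; rewrite ler_norml h.
by move=> [_ h] i; rewrite -ler_norml h.
Qed.

(** * Volume *)

Lemma continuous_tentX (R : realType) (T s : R) (n : nat) :
  continuous (fun x : R => (s - `|x| / T) ^+ n).
Proof.
move=> x; apply: (@continuous_comp _ _ _ (fun x : R => s - `|x| / T)
  (fun y => y ^+ n)); last exact: exprn_continuous.
apply: continuousB; first exact: cst_continuous.
by apply: continuousM; [exact: norm_continuous|exact: cst_continuous].
Qed.

Lemma integral_affineX (R : realType) (s k u v : R) (n : nat) :
  k != 0 -> u <= v ->
  (\int[lebesgue_measure]_(x in `[u, v]) ((s + k * x) ^+ n)%:E =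
   (((s + k * v) ^+ n.+1 - (s + k * u) ^+ n.+1) / (k * n.+1%:R))%:E)%E.
Proof.
move=> k0; rewrite le_eqVlt => /predU1P[->|uv].
  by rewrite set_itv1 integral_set1 subrr mul0r.
pose f x : R := (s + k * x) ^+ n.
pose F x : R := (k * n.+1%:R)^-1 * (s + k * x) ^+ n.+1.
have dF x : is_derive x (1 : R) F (f x).
  have d0 : is_derive x (1 : R) (fun y : R => s + k * y) k.
    have := is_deriveD (is_derive_cst s x 1) (is_deriveZ k (is_derive_id x 1)).
    by rewrite add0r /GRing.scale /= mulr1.
  have := is_deriveZ (k * n.+1%:R)^-1 (is_deriveX n.+1 d0).
  have -> : (k * n.+1%:R)^-1 \*: (fun y : R => s + k * y) ^+ n.+1 = F.
    by apply/funext => y; rewrite /F !fctE.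
  move=> h; apply: is_derive_eq.
  rewrite /GRing.scale /= /f mulrAC.
  by field; rewrite k0 nat1r pnatr_eq0.
have cF : continuous F.
  by move=> x; apply/differentiable_continuous/derivable1_diffP; case: (dF x).
have cf : continuous f.
  move=> x; apply: (@continuous_comp _ _ _ (fun x : R => s + k * x)
    (fun y => y ^+ n)); last exact: exprn_continuous.
  by apply: continuousD; [exact: cst_continuous|exact: mulrl_continuous].
rewrite (@continuous_FTC2 _ f F) //; first last.
- by move=> x _; rewrite derive1E; have [_ ->] := dF x.
- split.
  + by move=> x _; case: (dF x).
  + exact/cvg_at_right_filter/cF.
  + exact/cvg_at_left_filter/cF.
- exact: continuous_subspaceT.
by rewrite -EFinB /F -mulrBr mulrC.
Qed.

(** The integrand is affine in t on each side of 0, which gives two integrals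
of powers of affine functions. *)
Lemma integral_tentX (R : realType) (T s : R) (n : nat) : 0 < T -> 0 <= s ->
  (\int[lebesgue_measure]_(x in [set x : R | (0 <= s - `|x| / T)%R])
     ((s - `|x| / T) ^+ n)%:E = (2 * T * s ^+ n.+1 / n.+1%:R)%:E)%E.
Proof.
move=> T0 s0.
have Tn0 : T != 0 by rewrite gt_eqF.
have sT : 0 <= T * s by rewrite mulr_ge0// ltW.
have -> : [set x : R | 0 <= s - `|x| / T] = `[- (T * s), T * s]%classic.
  apply/seteqP; split=> x /=; rewrite in_itv /= -ler_norml subr_ge0.
    by rewrite ler_pdivrMr// mulrC.
  by move=> h; rewrite ler_pdivrMr// mulrC.
have mf (A : set R) : measurable_fun A (fun x : R => (s - `|x| / T) ^+ n).
  apply: measurable_funTS.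
  by apply: continuous_measurable_fun; exact: continuous_tentX.
have Ts0 : - (T * s) <= 0 by rewrite oppr_le0.
rewrite (@itv_bndbnd_setU _ _ (BLeft (- (T * s))) (BLeft 0)
  (BRight (T * s))) ?bnd_simp//.
rewrite ge0_integral_setU//; first last.
- apply/disj_setPRL => x /=; rewrite !in_itv/= => /andP[x0 _] /=.
  by rewrite ltNge x0 andbF.
- move=> x h; rewrite lee_fin exprn_ge0//.
  have : `[- (T * s), T * s]%classic x.
    by rewrite (@itv_bndbnd_setU _ _ _ (BLeft 0)) ?bnd_simp.
  rewrite /= in_itv /= -ler_norml subr_ge0 => h1.
  by rewrite ler_pdivrMr// mulrC.
- by apply/measurable_EFinP; exact: mf.
rewrite integral_itv_bndo_bndc//; last exact/measurable_EFinP.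
have -> : (\int[lebesgue_measure]_(x in `[(- (T * s))%R, 0%R])
      ((s - `|x| / T) ^+ n)%:E =
    \int[lebesgue_measure]_(x in `[(- (T * s))%R, 0%R]) ((s + T^-1 * x) ^+ n)%:E)%E.
  apply: eq_integral => x; rewrite inE/= in_itv/= => /andP[_ x0].
  by congr ((_ + _) ^+ _)%:E; rewrite (@ler0_norm R)// mulNr opprK mulrC.
have -> : (\int[lebesgue_measure]_(x in `[0%R, (T * s)%R])
      ((s - `|x| / T) ^+ n)%:E =
    \int[lebesgue_measure]_(x in `[0%R, (T * s)%R])
      ((s + (- T^-1) * x) ^+ n)%:E)%E.
  apply: eq_integral => x; rewrite inE/= in_itv/= => /andP[x0 _].
  by congr ((_ + _) ^+ _)%:E; rewrite (@ger0_norm R)// mulrC mulNr.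
rewrite !integral_affineX ?oppr_eq0 ?invr_eq0//.
rewrite -EFinD; congr EFin.
rewrite mulrN mulNr mulKf// subrr !mulr0 addr0 expr0n/= subr0 sub0r.
by field; rewrite Tn0 nat1r pnatr_eq0.
Qed.

(** The slice of the body at first coordinate x is a body of the same family:
fixing x uses up |x| / T of the slack.  The product measure is by definition the
integral of the measures of the slices. *)
Lemma vol_Jsublevel_step (R : realType) (n r : nat) (T s : R) :
  vol (Jsublevel R n.+1 r.+1 T s) =
  (\int[lebesgue_measure]_x vol (Jsublevel R n r T (s - `|x| / T)))%E.
Proof.
rewrite /vol /= /tuple_leb_step /pushforward /product_measure1 /=.
apply: eq_integral => x _ /=; congr (tuple_lebesgue n _).
rewrite xsectionE; apply/seteqP.
have e0 (t : n.-tuple (measurableTypeR R)) :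
    tnth (tcons (x, t)) ord0 = x by rewrite (tnth_nth x).
have eS (t : n.-tuple (measurableTypeR R)) i :
    tnth (tcons (x, t)) (lift ord0 i) = tnth t i.
  by rewrite tnthS; congr tnth; apply/val_inj.
have eslack (t : n.-tuple (measurableTypeR R)) :
    slack R n.+1 r.+1 T s (\row_i tnth (tcons (x, t)) i) =
    slack R n r T (s - `|x| / T) (\row_i tnth t i).
  rewrite /slack big_mkcond big_ord_recl /= !mxE e0.
  rewrite mulrDl opprD addrA [X in _ = _ - X / _]big_mkcond; congr (_ - _ / _).
  by apply: eq_bigr => i _; rewrite !mxE eS.
split=> t /=; rewrite /Jsublevel /= eslack => -[h1 h2]; split=> // i.
  by move=> ri; have := h2 (lift ord0 i); rewrite lift0 ltnS !mxE eS; exact.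
case: (unliftP ord0 i) => [j ->|-> //].
by rewrite lift0 ltnS => /h2; rewrite !mxE eS.
Qed.

Lemma vol_Jsublevel0 (R : realType) (n : nat) (T s : R) :
  vol (Jsublevel R n 0 T s) = (if 0 <= s then (2 * s) ^+ n else 0)%:E.
Proof.
rewrite /vol /Jsublevel /slack /=.
under eq_set do rewrite big_pred0_eq mul0r subr0.
case: ifPn => s0; last first.
  by rewrite (_ : [set _ | _] = set0) ?measure0// -subset0 => t [].
rewrite (_ : [set _ | _] =
  [set t : n.-tuple (measurableTypeR R) |
     forall i, `[- s, s]%classic (tnth t i)]).
  rewrite (@tuple_lebesgue_box R n (fun=> `[- s, s]%classic)) => [|_];
    last exact: measurable_itv.
  rewrite lebesgue_measure_itv /= lte_fin.
  rewrite (_ : (if _ then _ else _) = (2 * s)%:E).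
    by rewrite prodEFin prodr_const card_ord.
  case: ifPn => h; first by rewrite -EFinD; congr EFin; ring.
  by have -> : s = 0; [move: h; rewrite -leNgt; lra|rewrite mulr0].
apply/seteqP; split=> t /= => [[_ h] i|h].
  by have := h i isT; rewrite mxE in_itv/= ler_norml.
by split=> // i _; rewrite mxE ler_norml; have := h i; rewrite in_itv.
Qed.

(** Induction on r.  Negative s must be covered, with volume 0 also in dimension
0, because the slices at large |x| are of this kind. *)
Lemma vol_Jsublevel (R : realType) (n r : nat) (T s : R) : 0 < T -> (r <= n)%N ->
  vol (Jsublevel R n r T s) =
  (if 0 <= s then T ^+ r * 2 ^+ n * (n - r)`!%:R / n`!%:R * s ^+ n else 0)%:E.
Proof.
move=> T0; elim: r n s => [n s _|r IH [//|n] s rn].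
  rewrite vol_Jsublevel0; case: ifP => // _.
  by rewrite expr0 mul1r subn0 mulfK ?pnatr_eq0 -?lt0n ?fact_gt0// exprMn.
rewrite vol_Jsublevel_step.
under eq_integral do rewrite IH//.
set c := T ^+ r * 2 ^+ n * (n - r)`!%:R / n`!%:R.
have c0 : 0 <= c by rewrite divr_ge0// mulr_ge0// mulr_ge0// ?exprn_ge0// ltW.
pose D := [set x : R | 0 <= s - `|x| / T].
(* Slices outside D are empty, so the integral may be restricted to D. *)
transitivity (\int[lebesgue_measure]_(x in D) (c%:E * ((s - `|x| / T) ^+ n)%:E))%E.
  rewrite [RHS]integral_mkcond; apply: eq_integral => x _.
  rewrite patchE; case: ifPn => h.
    by rewrite mem_set.
  by rewrite memNset//=; apply/negP.
case: ifPn => s0; last first.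
  rewrite (_ : D = set0) ?integral_set0// -subset0 => x; rewrite /D /= => h.
  have : 0 <= `|x| / T by rewrite divr_ge0// ltW.
  by move: s0; rewrite -ltNge; lra.
have mD : measurable D.
  rewrite -[D]setTI /D.
  have -> : [set x : R | 0 <= s - `|x| / T] =
      (fun x => s - `|x| / T) @^-1` `[0, +oo[%classic.
    by apply/seteqP; split=> x /=; rewrite in_itv/= andbT.
  have : measurable_fun [set: R] (fun x : R => s - `|x| / T).
    by apply: continuous_measurable_fun; exact: (continuous_tentX R T s 1).
  by apply => //; exact: measurable_itv.
rewrite ge0_integralZl//; first last.
- by move=> x xD; rewrite lee_fin exprn_ge0.
- apply/measurable_EFinP; apply: measurable_funTS.
  by apply: continuous_measurable_fun; exact: continuous_tentX.
rewrite integral_tentX// -EFinM; congr EFin.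
rewrite /c subSS factS natrM !exprS.
by field; rewrite nat1r !pnatr_eq0 -lt0n fact_gt0.
Qed.

(** * Determinant of the integer lattice *)

Lemma det_int (R : realType) n (B : 'M[R]_n) :
  (forall i j, B i j \is a Num.int) -> \det B \is a Num.int.
Proof.
move=> h; apply: rpred_sum => s _; rewrite rpredMsign.
by apply: rpred_prod => i _.
Qed.

(** A basis matrix B of Z^n has integer entries because its rows lie in Z^n, and
so has its inverse because the standard basis vectors are integer combinations
of these rows.  Hence det B and its inverse are both integers. *)
Lemma lattice_det_int (R : realType) (n : nat) :
  lattice_det (int_lattice R n) = 1.
Proof.
rewrite /lattice_det; case: xgetP => [B _ [uB eB]|/(_ 1%:M)]; last first.
  case; split; first exact: unitmx1.
  by apply/seteqP; split=> [x xZ|_ [x xZ <-]]; [exists x|]; rewrite ?mulmx1.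
have intdelta i : int_lattice R n (delta_mx 0 i).
  by move=> j; rewrite mxE rpred_nat.
have intB i j : B i j \is a Num.int.
  have : int_lattice R n (row i B).
    by rewrite [int_lattice R n]eB; exists (delta_mx 0 i); rewrite ?rowE.
  by move=> /(_ j); rewrite mxE.
have intV i j : invmx B i j \is a Num.int.
  have : [set z *m B | z in int_lattice R n] (delta_mx 0 i) by rewrite -eB.
  move=> [z zint zB]; have -> : invmx B i j = z 0 j.
    by rewrite -[z](mulmxK uB) zB -rowE mxE.
  exact: zint.
have d0 : \det B != 0 by rewrite -unitfE -unitmxE.
have d1 : 1 <= `|\det B| by apply: norm_intr_ge1 => //; exact: det_int.
have : 1 <= `|\det (invmx B)|.
  by apply: norm_intr_ge1; [exact: det_int|rewrite det_inv invr_eq0].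
rewrite det_inv normfV => d2; apply/eqP; rewrite eq_le d1 andbT.
by rewrite -invr_ge1 ?unitfE ?normr_eq0// normr_gt0.
Qed.

(** * Coordinate subspaces and orthogonal projection *)

Lemma dotv_delta (R : realType) (n : nat) (u : 'rV[R]_n) i :
  dotv u (delta_mx 0 i) = u 0 i.
Proof.
rewrite /dotv (bigD1 i)//= big1 ?addr0 => [|j ji]; rewrite !mxE !eqxx /= ?mulr1//.
by rewrite (negbTE ji) mulr0.
Qed.

(** Turns the vanishing of a coordinate into membership in a subspace, so that it
can be checked on a spanning family. *)
Lemma mem_orthov_delta (R : realType) (n : nat) (x : 'rV[R]_n) i :
  (x \in orthov dotv <[delta_mx 0%R i : 'rV[R]_n]>) = (x 0 i == 0).
Proof. by rewrite mem_orthov1 -dotv_delta. Qed.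

Lemma coord_spaceP (R : realType) (n r : nat) (x : 'rV[R]_n) :
  reflect (forall i : 'I_n, (r <= i)%N -> x 0 i = 0) (x \in coord_space R n r).
Proof.
apply: (iffP idP) => [xL i ri|h]; last first.
  rewrite [x]row_sum_delta; apply: memv_suml => i _.
  have [ir|ri] := ltnP i r; last by rewrite h// scale0r mem0v.
  by apply/memvZ/memv_span/map_f; rewrite mem_filter ir mem_enum.
suff : (coord_space R n r <= orthov dotv <[delta_mx 0%R i : 'rV[R]_n]>)%VS.
  by move=> /subvP/(_ x xL); rewrite mem_orthov_delta => /eqP.
apply/span_subvP => _ /mapP[j + ->]; rewrite mem_filter => /andP[jr _].
rewrite mem_orthov_delta mxE eqxx /=.
by case: (eqVneq i j) ri => [->|_ _]; rewrite ?eqxx// leqNgt jr.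
Qed.

Lemma orthov_coord_spaceP (R : realType) (n r : nat) (x : 'rV[R]_n) :
  reflect (forall i : 'I_n, (i < r)%N -> x 0 i = 0)
    (x \in orthov dotv (coord_space R n r)).
Proof.
apply: (iffP idP) => [/mem_orthovP xL i ir|h].
  rewrite -dotv_delta; apply/xL/coord_spaceP => j rj; rewrite mxE eqxx /=.
  by case: eqP rj => // ->; rewrite leqNgt ir.
apply/mem_orthovP => v /coord_spaceP vL; rewrite -[LHS]/(dotv x v) /dotv big1// => i _.
by have [/h ->|/vL ->] := ltnP i r; rewrite ?mul0r ?mulr0.
Qed.

Lemma proj_coord_spaceE (R : realType) (n r : nat) (x : 'rV[R]_n) :
  proj_perp (coord_space R n r) x = \row_i (if (i < r)%N then 0 else x 0 i).
Proof.
have [/orthov_coord_spaceP h1 /coord_spaceP h2] := proj_perpP (coord_space R n r) x.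
apply/rowP => i; rewrite mxE; case: ltnP => [/h1 //|/h2].
by rewrite !mxE => /eqP; rewrite subr_eq0 => /eqP.
Qed.

(** The family of all standard basis vectors is free as it generates a space of
dimension its size; up to a permutation, the generators of the coordinate
subspace are an initial part of it. *)
Lemma dim_coord_space (R : realType) (n r : nat) : (r <= n)%N ->
  \dim (coord_space R n r) = r.
Proof.
move=> rn; rewrite /coord_space; set f := fun i : 'I_n => delta_mx 0 i : 'rV[R]_n.
set p := fun i : 'I_n => (i < r)%N; set s := enum 'I_n.
have fr : free [seq f i | i <- s].
  rewrite /free size_map size_enum_ord eqn_leq; apply/andP; split.
    by rewrite (leq_trans (dim_span _))// size_map size_enum_ord.
  have -> : <<[seq f i | i <- s]>>%VS = fullv.
    apply/eqP; rewrite eqEsubv subvf; apply/subvP => x _.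
    rewrite [x]row_sum_delta; apply: memv_suml => i _.
    by apply/memvZ/memv_span/map_f; rewrite mem_enum.
  by rewrite dimvf dim_matrix mul1r.
have : free ([seq f i | i <- s & p i] ++ [seq f i | i <- s & predC p i]).
  by rewrite -map_cat (perm_free (Y := map f s))//; apply/perm_map; rewrite perm_filterC.
move=> /catl_free/eqP ->.
rewrite size_map size_filter -(count_map val (fun k => k < r)%N) val_enum_ord.
rewrite -(subnKC rn) iotaD count_cat add0n.
rewrite (@eq_in_count _ _ predT) => [|k]; last by rewrite mem_iota => /andP[].
rewrite count_predT size_iota (@eq_in_count _ _ pred0) ?count_pred0 ?addn0// => k.
by rewrite mem_iota => /andP[rk _]; rewrite ltnNge rk.
Qed.

(** * Successive minima *)

Lemma set_min_eq (R : realType) (S : set R) a :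
  S a -> lbound S a -> set_min S = a.
Proof.
move=> Sa la; rewrite /set_min; case: xgetP => [b _ [Sb lb]|/(_ a) []//].
by apply/eqP; rewrite eq_le la// lb.
Qed.

(** For l < 1/T a lattice point of the dilate by l is 0: in absolute value, its
first r coordinates are at most l T < 1, and the others at most l < 1 since
1 <= T. *)
Lemma succ_min_Jsublevel (R : realType) (n r i : nat) (T : R) :
  1 <= T -> (r <= n)%N -> (0 < i <= r)%N ->
  succ_min i (Jsublevel R n r T 1) (int_lattice R n) = T^-1.
Proof.
move=> T1 rn /andP[i0 ir]; have T0 : 0 < T by rewrite (lt_le_trans _ T1).
apply: set_min_eq => [|l [l0 il]].
  split; first by rewrite invr_gt0.
  rewrite (leq_trans ir)// -[leqLHS](dim_coord_space R n r rn) /sdim dimvS//.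
  set A := dilate _ _ `&` _.
  apply/span_subvP => _ /mapP[j + ->]; rewrite mem_filter => /andP[jr _].
  apply: (lspanP A).1; split; last by move=> k; rewrite mxE rpred_nat.
  exists (T *: delta_mx 0 j); last by rewrite scalerA mulVf ?scale1r// gt_eqF.
  (* T e_j exhausts the slack, leaving 0 for the last coordinates. *)
  have sl0 : slack R n r T 1 (T *: delta_mx 0 j) = 0.
    rewrite /slack (bigD1 j)//= big1 => [|k /andP[_ /negbTE kj]].
      by rewrite !mxE !eqxx mulr1 addr0 gtr0_norm// divff ?subrr// gt_eqF.
    by rewrite !mxE kj andbF mulr0 normr0.
  rewrite /Jsublevel /= sl0; split=> // k rk; rewrite !mxE.
  have /negbTE -> : k != j by apply: contraTneq rk => ->; rewrite -ltnNge.
  by rewrite andbF mulr0 normr0.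
rewrite leNgt; apply/negP => lT.
have lT1 : l * T < 1 by rewrite -ltr_pdivlMr// div1r.
have l1 : l < 1 by rewrite (lt_le_trans lT)// invf_le1.
suff s0 : (lspan (dilate l (Jsublevel R n r T 1) `&` int_lattice R n) <= 0)%VS.
  by move: il; rewrite /sdim; move: s0; rewrite subv0 => /eqP ->; rewrite dimv0 leqNgt i0.
apply: (lspanP _).2 => x [[z [sl zsl] <-] lz] /=; rewrite memv0.
apply/eqP/rowP => j; rewrite [RHS]mxE; apply/eqP/negP => /negP x0.
have := norm_intr_ge1 (lz j) x0; apply/negP; rewrite -ltNge mxE normrM (gtr0_norm l0).
have sum0 (P : pred 'I_n) : 0 <= \sum_(k < n | P k) `|z 0 k| by exact: sumr_ge0.
have [jr|rj] := ltnP j r.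
  apply: le_lt_trans lT1; rewrite ler_pM2l//.
  move: sl; rewrite /slack subr_ge0 ler_pdivrMr// mul1r; apply: le_trans.
  by rewrite (bigD1 j)//= lerDl.
apply: le_lt_trans l1; rewrite -[leRHS]mulr1 ler_pM2l//.
by rewrite (le_trans (zsl j rj))// gerBl divr_ge0// ltW.
Qed.

(** * Covering radius *)

Lemma inf_eq (R : realType) (S : set R) a : S a -> lbound S a -> inf S = a.
Proof.
move=> Sa la; apply/eqP; rewrite eq_le; apply/andP; split.
  by apply: ge_inf => //; exists a.
by apply: lb_le_inf => //; exists a.
Qed.

(** The cube [-h, h]^(n-r) placed in the orthogonal complement of the first r
coordinates. *)
Definition flatbox (R : realType) (n r : nat) (h : R) : set 'rV[R]_n :=
  [set y | forall i : 'I_n, `|y 0 i| <= if (i < r)%N then 0 else h].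

Lemma proj_Jsublevel (R : realType) (n r : nat) (T s : R) : 0 < T -> 0 <= s ->
  proj_perp (coord_space R n r) @` Jsublevel R n r T s = flatbox R n r s.
Proof.
move=> T0 s0; apply/seteqP; split=> [_ [z [_ zsl] <-] i|y h].
  rewrite proj_coord_spaceE mxE; case: ltnP => [_|ri]; first by rewrite normr0.
  rewrite (le_trans (zsl i ri))// gerBl divr_ge0 ?(ltW T0)//.
  exact: sumr_ge0.
have y0 (i : 'I_n) : (i < r)%N -> y 0 i = 0.
  by move=> ir; have := h i; rewrite ir normr_le0 => /eqP.
exists y; last first.
  by rewrite proj_coord_spaceE; apply/rowP => i; rewrite mxE; case: ifP => // /y0.
rewrite /Jsublevel /slack /= big1 => [|i /y0 ->]; last by rewrite normr0.
rewrite mul0r subr0; split=> // i ri; by have := h i; rewrite ltnNge ri.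
Qed.

Lemma half_int_dist (R : realType) (g : R) : g \is a Num.int -> 2^-1 <= `|2^-1 - g|.
Proof.
move=> /intrP[m ->]; rewrite ler_normr.
have [m0|m1] : (m <= 0)%R \/ (1 <= m)%R by lia.
  by apply/orP; left; move: m0; rewrite -(ler_int R); lra.
by apply/orP; right; move: m1; rewrite -(ler_int R); lra.
Qed.

(** The assumption r < n provides a coordinate in which to look at the deep hole
(1/2, ..., 1/2). *)
Lemma covering_radius_flatbox (R : realType) (n r : nat) (h : R) :
  (r < n)%N -> 0 < h ->
  covering_radius (orthov dotv (coord_space R n r)) (flatbox R n r h)
    (proj_perp (coord_space R n r) @` int_lattice R n) = (2 * h)^-1.
Proof.
move=> rn h0; apply: inf_eq => [|mu [mu0 cov]].
  split; first by rewrite invr_gt0 mulr_gt0.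
  apply/seteqP; split=> [_ [_ [c cC <-] [_ [g gZ <-] <-]]|y /orthov_coord_spaceP y0].
    apply/orthov_coord_spaceP => i ir; rewrite proj_coord_spaceE !mxE ir addr0.
    by have := cC i; rewrite ir normr_le0 => /eqP ->; rewrite mulr0.
  (* The nearest lattice point: floor (y_i + 1/2) is within 1/2 of y_i. *)
  pose g : 'rV[R]_n := \row_i (Num.floor (y 0 i + 2^-1))%:~R.
  have pgE := proj_coord_spaceE R n r g.
  exists (y - proj_perp (coord_space R n r) g); last first.
    exists (proj_perp (coord_space R n r) g); last by rewrite subrK.
    by exists g => // i; rewrite mxE intr_int.
  exists ((2 * h) *: (y - proj_perp (coord_space R n r) g)); last first.
    by rewrite scalerA mulVf ?scale1r// mulf_neq0 ?gt_eqF.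
  move=> i; rewrite pgE !mxE; case: ifPn => ir.
    by rewrite y0// subr0 mulr0 normr0.
  have := floor_itv (y 0 i + 2^-1); rewrite intrD; set f := (Num.floor _)%:~R => /andP[f1 f2].
  rewrite normrM gtr0_norm ?mulr_gt0//.
  have : `|y 0 i - f| <= 2^-1 by rewrite ler_norml; apply/andP; split; lra.
  by rewrite -(ler_pM2l h0); lra.
pose y : 'rV[R]_n := \row_i (if (i < r)%N then 0 else 2^-1).
have : [set` orthov dotv (coord_space R n r)] y.
  by apply/orthov_coord_spaceP => i ir; rewrite mxE ir.
rewrite -cov => -[_ [c cC <-] [_ [g gZ <-]]] /rowP/(_ (Ordinal rn)).
rewrite proj_coord_spaceE !mxE /= ltnn => e.
have := half_int_dist R _ (gZ (Ordinal rn)); rewrite -e addrK normrM gtr0_norm// => d.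
have := cC (Ordinal rn); rewrite /= ltnn -(ler_pM2l mu0) => /(le_trans d).
by rewrite -[_^-1]mul1r ler_pdivrMr ?mulr_gt0//; lra.
Qed.

(** * The three equality cases *)

Lemma coord_space0 (R : realType) (n : nat) : coord_space R n 0 = 0%VS.
Proof. by apply/eqP; rewrite -dimv_eq0 dim_coord_space. Qed.

(** The factorials and 2^r cancel against those in the volume. *)
Lemma volume_bound_Jsublevel (R : realType) (n r : nat) (T s : R) :
  0 < T -> 0 < s -> (r <= n)%N ->
  volume_bound r (Jsublevel R n r T s) (int_lattice R n) =
  T^-1 ^+ r * ((2 * s)^-1 ^+ (n - r)) * s^-1 ^+ r.
Proof.
move=> T0 s0 rn; rewrite /volume_bound lattice_det_int vol_Jsublevel// (ltW s0) /=.
have F m : (m`!%:R : R) != 0 by rewrite pnatr_eq0 -lt0n fact_gt0.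
have expn (x : R) : x ^+ n = x ^+ (n - r) * x ^+ r by rewrite -exprD subnK.
rewrite !expn !exprVn exprMn.
by field; rewrite !F !expf_neq0 ?pnatr_eq0// gt_eqF.
Qed.

Theorem mainTheorem4 (R : realType) (n : nat) (n_ge1 : (1 <= n)%N) :
  [/\ covering_product 0 (cube R n) (int_lattice R n) 0%VS =
        volume_bound 0 (cube R n) (int_lattice R n),
      covering_product n (cross_polytope R n) (int_lattice R n) fullv =
        volume_bound n (cross_polytope R n) (int_lattice R n)
    & forall (r : nat) (T : R), (0 < r < n)%N -> 1 <= T ->
        covering_product r (Jbody R n r T) (int_lattice R n)
          (coord_space R n r) =
        volume_bound r (Jbody R n r T) (int_lattice R n)].
Proof.
have prod_min r T : 1 <= T -> (r <= n)%N ->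
    \prod_(1 <= i < r.+1) succ_min i (Jsublevel R n r T 1) (int_lattice R n) = T^-1 ^+ r.
  move=> T1 rn; rewrite (eq_big_nat _ _ (F2 := fun=> T^-1)) => [|i ir].
    by rewrite prodr_const_nat subn1.
  exact: succ_min_Jsublevel.
split.
- rewrite cube_Jsublevel volume_bound_Jsublevel ?invr_gt0// /covering_product.
  rewrite big_geq// -coord_space0 proj_Jsublevel ?invr_ge0//.
  by rewrite covering_radius_flatbox ?invr_gt0// !expr0 mul1r mulr1.
- rewrite cross_polytope_Jsublevel volume_bound_Jsublevel// /covering_product prod_min//.
  by rewrite subnn !expr0 invr1 expr1n !mulr1.
- move=> r T /andP[r0 rn] T1; have T0 : 0 < T by rewrite (lt_le_trans _ T1).
  rewrite Jbody_Jsublevel volume_bound_Jsublevel ?(ltnW rn)// /covering_product.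
  rewrite prod_min ?(ltnW rn)// proj_Jsublevel// covering_radius_flatbox//.
  by rewrite invr1 expr1n !mulr1.
Qed.
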